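(* Let $n\ge 2$ and $G_1,G_2\in\{\mathbb{B}^n,\mathbb{H}^n\}$, where $\mathbb{B}^n$ is the open unit ball and $\mathbb{H}^n$ the upper half space of $\mathbb{R}^n$. Let $f:G_1\to G_2$ be a bilipschitz map with respect to the visual angle metrics $v_{G_1}$ and $v_{G_2}$. Then $f$ is also a bilipschitz map with respect to the hyperbolic metrics $\rho_{G_1}$ and $\rho_{G_2}$.
   Context: For a domain $G\subsetneq\mathbb{R}^n$ whose boundary $\partial G$ is not a proper subset of a line, the visual angle metric is $v_G(x,y)=\sup_{z\in\partial G}\measuredangle(x,z,y)$ for $x,y\in G$, where $\measuredangle(x,z,y)\in[0,\pi]$ is the angle at $z$ between the segments $[x,z]$ and $[y,z]$ (so $v_G(x,x)=0$). $\mathbb{H}^n=\{(z_1,\dots,z_n)\in\mathbb{R}^n: z_n>0\}$. The hyperbolic metrics are given by $$\cosh\rho_{\mathbb{H}^n}(x,y)=1+\frac{|x-y|^2}{2x_ny_n}\ (x,y\in\mathbb{H}^n),\qquad \sinh\frac{\rho_{\mathbb{B}^n}(x,y)}{2}=\frac{|x-y|}{\sqrt{1-|x|^2}\sqrt{1-|y|^2}}\ (x,y\in\mathbb{B}^n).$$ A map $f:(X,d_X)\to(Y,d_Y)$ of metric spaces is $L$-bilipschitz ($L\ge1$) if it is a homeomorphism (of $X$ onto $Y$) and $d_X(x,y)/L\le d_Y(f(x),f(y))\le L\,d_X(x,y)$ for all $x,y\in X$; it is bilipschitz if it is $L$-bilipschitz for some $L\ge1$. *)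

(* Defs.v *)
From HB Require Import structures.
From mathcomp Require Import all_boot all_order all_algebra.
From mathcomp Require Import all_classical all_reals all_analysis.
From mathcomp Require Import ring lra.

Set Implicit Arguments.
Unset Strict Implicit.
Unset Printing Implicit Defensive.

Import Order.TTheory GRing.Theory Num.Theory.
Import numFieldNormedType.Exports.

Local Open Scope classical_set_scope.
Local Open Scope ring_scope.

(* The library norm `|u| on 'rV[R]_n is the sup norm, so the Euclidean inner
   product and norm are defined here. The library topology on 'rV[R]_n is the
   product topology, that is, the usual topology of R^n. *)
Section Euclidean.
Variables (R : realType) (n : nat).
Implicit Types u v x y z : 'rV[R]_n.

Definition dotv u v : R := \sum_(i < n) u ord0 i * v ord0 i.

Definition enorm u : R := Num.sqrt (dotv u u).

(* The angle at z between the segments [x, z] and [y, z]; it is meaningful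
   when z differs from x and from y. *)
Definition angle x z y : R :=
  acos (dotv (x - z) (y - z) / (enorm (x - z) * enorm (y - z))).

Lemma dotv_ge0 u : 0 <= dotv u u.
Proof. by apply: sumr_ge0 => i _; rewrite -expr2 sqr_ge0. Qed.

Lemma enorm_ge0 u : 0 <= enorm u.
Proof. exact: sqrtr_ge0. Qed.

Lemma dotv_sqr_le u v : dotv u v ^+ 2 <= dotv u u * dotv v v.
Proof.
have quad s t :
    0 <= s ^+ 2 * dotv u u - 2 * (s * t) * dotv u v + t ^+ 2 * dotv v v.
  have -> : s ^+ 2 * dotv u u - 2 * (s * t) * dotv u v + t ^+ 2 * dotv v v
      = \sum_(i < n) (s * u ord0 i - t * v ord0 i) ^+ 2.
    rewrite /dotv !mulr_sumr -sumrB -big_split /=.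
    by apply: eq_bigr => i _; ring.
  by apply: sumr_ge0 => i _; exact: sqr_ge0.
have := dotv_ge0 u; rewrite le_eqVlt => /predU1P[u0|u_gt0].
  have := quad (dotv u v * (dotv v v + 1)) (dotv u v ^+ 2).
  have := quad (dotv u v) (dotv u u).
  have := quad (dotv v v + 1) (dotv u v); have := dotv_ge0 v.
  rewrite -u0; nra.
have := quad (dotv u v) (dotv u u).
have -> : dotv u v ^+ 2 * dotv u u - 2 * (dotv u v * dotv u u) * dotv u v
    + dotv u u ^+ 2 * dotv v v
    = dotv u u * (dotv u u * dotv v v - dotv u v ^+ 2) by ring.
by rewrite pmulr_rge0// subr_ge0.
Qed.

Lemma angle_itv x z y : 0 <= angle x z y <= pi.
Proof.
suff h : -1 <= dotv (x - z) (y - z) / (enorm (x - z) * enorm (y - z)) <= 1.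
  by rewrite acos_ge0// acos_lepi.
rewrite -ler_norml normrM normfV.
rewrite [X in _ / X]ger0_norm ?mulr_ge0 ?enorm_ge0//.
have [->|nz] := eqVneq (enorm (x - z) * enorm (y - z)) 0.
  by rewrite invr0 mulr0 ler01.
have p : 0 < enorm (x - z) * enorm (y - z).
  by rewrite lt_neqAle eq_sym nz mulr_ge0 ?enorm_ge0.
rewrite ler_pdivrMr// mul1r -sqrtr_sqr /enorm -sqrtrM ?dotv_ge0//.
by rewrite ler_wsqrtr// dotv_sqr_le.
Qed.

End Euclidean.

Section VisualAngle.
Variables (R : realType) (n : nat).

Definition boundary (G : set 'rV[R]_n) : set 'rV[R]_n :=
  closure G `\` interior G.

Definition visual_angle (G : set 'rV[R]_n) (x y : 'rV[R]_n) : R :=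
  sup [set angle x z y | z in boundary G].

End VisualAngle.

Section Hyperbolic.
Variable R : realType.

Definition cosh (t : R) : R := (expR t + expR (- t)) / 2.
Definition sinh (t : R) : R := (expR t - expR (- t)) / 2.
Definition arcosh (t : R) : R := ln (t + Num.sqrt (t ^+ 2 - 1)).
Definition arsinh (t : R) : R := ln (t + Num.sqrt (t ^+ 2 + 1)).

Lemma arcosh_ge0 t : 1 <= t -> 0 <= arcosh t.
Proof. by move=> t1; rewrite ln_ge0// ler_wpDr// sqrtr_ge0. Qed.

Lemma arcoshK t : 1 <= t -> cosh (arcosh t) = t.
Proof.
move=> t1; rewrite /cosh /arcosh.
set s := Num.sqrt _.
have s0 : 0 <= s by exact: sqrtr_ge0.
have sE : s ^+ 2 = t ^+ 2 - 1 by rewrite sqr_sqrtr// subr_ge0 expr_ge1//; lra.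
have p : 0 < t + s by lra.
have -> : expR (- ln (t + s)) = t - s.
  rewrite expRN lnK ?posrE//; apply: (mulfI (lt0r_neq0 p)).
  by rewrite divff ?lt0r_neq0// mulrC -subr_sqr sE; ring.
by rewrite lnK ?posrE//; field.
Qed.

Lemma arsinhK t : sinh (arsinh t) = t.
Proof.
rewrite /sinh /arsinh; set s := Num.sqrt _.
have s0 : 0 <= s by exact: sqrtr_ge0.
have sE : s ^+ 2 = t ^+ 2 + 1 by rewrite sqr_sqrtr// addr_ge0 ?sqr_ge0.
have p : 0 < t + s by nra.
have -> : expR (- ln (t + s)) = s - t.
  rewrite expRN lnK ?posrE//; apply: (mulfI (lt0r_neq0 p)).
  by rewrite divff ?lt0r_neq0// addrC mulrC -subr_sqr sE; ring.
by rewrite lnK ?posrE//; field.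
Qed.

Variable n : nat.
Implicit Types x y : 'rV[R]_n.+1.

Definition unit_ball : set 'rV[R]_n.+1 := [set x | enorm x < 1].
Definition half_space : set 'rV[R]_n.+1 := [set x | 0 < x ord0 ord_max].

Definition rho_ball x y : R :=
  2 * arsinh (enorm (x - y) /
    (Num.sqrt (1 - enorm x ^+ 2) * Num.sqrt (1 - enorm y ^+ 2))).

Definition rho_half x y : R :=
  arcosh (1 + enorm (x - y) ^+ 2 / (2 * x ord0 ord_max * y ord0 ord_max)).

Lemma sinh_rho_ball x y : sinh (rho_ball x y / 2) =
  enorm (x - y) / (Num.sqrt (1 - enorm x ^+ 2) * Num.sqrt (1 - enorm y ^+ 2)).
Proof. by rewrite /rho_ball mulrC mulKf ?pnatr_eq0// arsinhK. Qed.

Let rho_half_arg x y : half_space x -> half_space y ->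
  1 <= 1 + enorm (x - y) ^+ 2 / (2 * x ord0 ord_max * y ord0 ord_max).
Proof.
rewrite /half_space /= => x0 y0.
by rewrite lerDl divr_ge0 ?sqr_ge0// !mulr_ge0// ltW.
Qed.

Lemma rho_half_ge0 x y : half_space x -> half_space y -> 0 <= rho_half x y.
Proof. by move=> x0 y0; exact/arcosh_ge0/rho_half_arg. Qed.

Lemma cosh_rho_half x y : half_space x -> half_space y ->
  cosh (rho_half x y) =
  1 + enorm (x - y) ^+ 2 / (2 * x ord0 ord_max * y ord0 ord_max).
Proof. by move=> x0 y0; exact/arcoshK/rho_half_arg. Qed.

End Hyperbolic.

Inductive model := Ball | Half.

Definition domain (R : realType) (n : nat) (m : model) : set 'rV[R]_n.+1 :=
  match m with Ball => @unit_ball R n | Half => @half_space R n end.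

Definition rho (R : realType) (n : nat) (m : model) :
    'rV[R]_n.+1 -> 'rV[R]_n.+1 -> R :=
  match m with Ball => @rho_ball R n | Half => @rho_half R n end.

(* A map between the metric spaces (A, dA) and (B, dB), with A and B subsets of
   S and T, is given by a total function S -> T whose values outside A are
   irrelevant. Continuity refers to the topologies defined by dA and dB. *)
Section Bilipschitz.
Variables (R : realType) (S T : Type).

Definition metric_continuous (S' T' : Type) (A : set S') (dA : S' -> S' -> R)
    (dB : T' -> T' -> R) (f : S' -> T') : Prop :=
  forall x, A x -> forall e, 0 < e -> exists2 d, 0 < d &
    forall y, A y -> dA x y < d -> dB (f x) (f y) < e.

Definition homeomorphism (A : set S) (dA : S -> S -> R)
    (B : set T) (dB : T -> T -> R) (f : S -> T) : Prop :=
  set_fun A B f /\ metric_continuous A dA dB f /\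
  exists g : T -> S,
    [/\ set_fun B A g, forall x, A x -> g (f x) = x,
        forall y, B y -> f (g y) = y & metric_continuous B dB dA g].

Definition L_bilipschitz (L : R) (A : set S) (dA : S -> S -> R)
    (B : set T) (dB : T -> T -> R) (f : S -> T) : Prop :=
  homeomorphism A dA B dB f /\
  forall x y, A x -> A y ->
    dA x y / L <= dB (f x) (f y) /\ dB (f x) (f y) <= L * dA x y.

Definition bilipschitz (A : set S) (dA : S -> S -> R)
    (B : set T) (dB : T -> T -> R) (f : S -> T) : Prop :=
  exists2 L : R, 1 <= L & L_bilipschitz L A dA B dB f.

End Bilipschitz.

(* Main.v *)
Require Import Defs.
From mathcomp Require Import all_boot all_order all_algebra.
From mathcomp Require Import all_classical all_reals all_analysis.
From mathcomp Require Import ring lra.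

(** The visual angle metric v is bounded, but at small scales it is comparable
    to the hyperbolic metric rho, with constants that do not depend on the
    place.  A v-bilipschitz map is therefore rho-Lipschitz at some fixed scale,
    and so is its inverse; because hyperbolic space is geodesic, a map that is
    Lipschitz at a fixed scale is Lipschitz with the same constant.

    The ball and the half space are treated together.  With the height
    h(x) = (1 - |x|^2) / 2 in the ball and h(x) = x_n in the half space, the
    number k(x, y) = |x - y| / sqrt (h(x) h(y)), called [chord], equals
    2 sinh (rho(x, y) / 2) in both models ([chordE]), so k is comparable to rho
    at small scales, and the boundary is the zero set of h.

    Upper bound for v ([visual_le_chord]).  A boundary point z is at distance
    at least h(x) from x and h(y) from y, so the law of cosines bounds
    1 - cos of the angle at z by k^2 / 2.

    Lower bound for v ([chord_le_visual]).  Let h(x) <= h(y).  There are two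
    boundary points z at distance comparable to h(x) from x such that the two
    vectors x - z are a e1 + b e2 and a e1 - b e2 with e1, e2 orthonormal and
    a, b comparable to h(x) ([boundary_cross]).  The line through x and y cannot
    pass close to both of them ([exists_transversal]), and from a boundary point
    at distance at least h(x) / 2 from that line the pair x, y is seen under an
    angle of the order of k / (k + 1).

    Geodesics.  Both models are isometric to the hyperboloid
    t^2 = 1 + |u|^2 in Minkowski space, where cosh rho is the Lorentz product
    ([lorentz_embed], [embed_surj]).  There the triangle inequality is the
    Cauchy-Schwarz inequality on the spacelike complement of a timelike vector
    ([rho_triangle]), and the midpoint of X and Y is the normalisation of X + Y
    ([rho_midpoint]).  Halving the distance repeatedly brings any pair of points
    down to the fixed scale ([lipschitz_of_scale]). *)

Set Implicit Arguments.
Unset Strict Implicit.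
Unset Printing Implicit Defensive.

Import Order.TTheory GRing.Theory Num.Theory.
Import numFieldNormedType.Exports.

Local Open Scope classical_set_scope.
Local Open Scope ring_scope.

(** * Euclidean space *)

Section EuclideanSpace.
Variables (R : realType) (n : nat).
Implicit Types (u v w x y z : 'rV[R]_n) (a b c d : R).

Lemma dotvC u v : dotv u v = dotv v u.
Proof. by apply: eq_bigr => i _; rewrite mulrC. Qed.

Lemma dotvDl u v w : dotv (u + v) w = dotv u w + dotv v w.
Proof. by rewrite -big_split; apply: eq_bigr => i _; rewrite mxE mulrDl. Qed.

Lemma dotvZl a u v : dotv (a *: u) v = a * dotv u v.
Proof. by rewrite mulr_sumr; apply: eq_bigr => i _; rewrite mxE mulrA. Qed.

Lemma dotvNl u v : dotv (- u) v = - dotv u v.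
Proof. by rewrite -scaleN1r dotvZl mulN1r. Qed.

Lemma dotvDr u v w : dotv w (u + v) = dotv w u + dotv w v.
Proof. by rewrite dotvC dotvDl !(dotvC w). Qed.

Lemma dotvZr a u v : dotv u (a *: v) = a * dotv u v.
Proof. by rewrite dotvC dotvZl (dotvC u). Qed.

Lemma dotvNr u v : dotv u (- v) = - dotv u v.
Proof. by rewrite dotvC dotvNl (dotvC u). Qed.

Definition dotvE := (dotvDl, dotvDr, dotvZl, dotvZr, dotvNl, dotvNr).

Lemma dotv0l u : dotv 0 u = 0.
Proof. by rewrite -(scale0r u) dotvZl mul0r. Qed.

Lemma dotv_delta u (i : 'I_n) : dotv u (delta_mx ord0 i) = u ord0 i.
Proof.
rewrite /dotv (bigD1 i)//= big1 ?addr0 => [|j ji].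
  by rewrite mxE !eqxx mulr1.
by rewrite mxE (negbTE ji) andbF mulr0.
Qed.

Lemma dotv_eq0 u : dotv u u = 0 -> u = 0.
Proof.
move=> /eqP; rewrite /dotv psumr_eq0 => [/allP u0|i _]; last first.
  by rewrite -expr2 sqr_ge0.
apply/rowP => i; rewrite mxE; apply/eqP.
by have := u0 i (mem_index_enum i); rewrite mulf_eq0 orbb.
Qed.

Lemma sqr_enorm u : enorm u ^+ 2 = dotv u u.
Proof. by rewrite sqr_sqrtr// dotv_ge0. Qed.

Lemma enormN u : enorm (- u) = enorm u.
Proof. by rewrite /enorm dotvNl dotvNr opprK. Qed.

Lemma enorm_le a u : 0 <= a -> dotv u u <= a ^+ 2 -> enorm u <= a.
Proof.
by move=> a0 h; rewrite -(ger0_norm a0) -sqrtr_sqr ler_wsqrtr.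
Qed.

Lemma dotv_le u v : dotv u v <= enorm u * enorm v.
Proof.
rewrite (le_trans (ler_norm _))// -sqrtr_sqr /enorm -sqrtrM ?dotv_ge0//.
by rewrite ler_wsqrtr// dotv_sqr_le.
Qed.

Lemma enormD u v : enorm (u + v) <= enorm u + enorm v.
Proof.
apply: enorm_le; first by rewrite addr_ge0// enorm_ge0.
rewrite !dotvE (dotvC v u) sqrrD !sqr_enorm.
by have := dotv_le u v; lra.
Qed.

Lemma enormB_ge u v : enorm u - enorm v <= enorm (u - v).
Proof. by rewrite lerBlDr -{1}(subrK v u) enormD. Qed.

Lemma coord_le_enorm u (i : 'I_n) : `|u ord0 i| <= enorm u.
Proof.
rewrite -sqrtr_sqr ler_wsqrtr// /dotv (bigD1 i)//= expr2 lerDl.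
by apply: sumr_ge0 => j _; rewrite -expr2 sqr_ge0.
Qed.

(** Bessel's inequality for an orthonormal pair: the square of the distance
    from [d] to the plane of [e1] and [e2] is nonnegative. *)
Lemma bessel2 (e1 e2 d : 'rV[R]_n) :
  dotv e1 e1 = 1 -> dotv e2 e2 = 1 -> dotv e1 e2 = 0 ->
  dotv e1 d ^+ 2 + dotv e2 d ^+ 2 <= dotv d d.
Proof.
move=> e11 e22 e12.
have := dotv_ge0 (d - dotv e1 d *: e1 - dotv e2 d *: e2).
rewrite !dotvE e11 e22 (dotvC e2 e1) e12 (dotvC d e1) (dotvC d e2).
by rewrite !expr2; lra.
Qed.

Lemma enorm_continuous : continuous (@enorm R n).
Proof.
move=> u; apply: (@continuous_comp _ _ _ (fun u => dotv u u) Num.sqrt).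
  apply: (continuous_big add_continuous) => i _ {}u.
  by apply: continuousM; exact: coord_continuous.
exact: sqrt_continuous.
Qed.

End EuclideanSpace.

(** * Hyperbolic functions *)

Section HyperbolicFunctions.
Variable R : realType.
Implicit Types a b t : R.

Lemma cosh2_sinh2 a : cosh a ^+ 2 - sinh a ^+ 2 = 1.
Proof.
have e : expR a * expR (- a) = 1 by rewrite -expRD subrr expR0.
by rewrite /cosh /sinh -[RHS]e; field.
Qed.

Lemma coshD a b : cosh (a + b) = cosh a * cosh b + sinh a * sinh b.
Proof. by rewrite /cosh /sinh opprD !expRD; field. Qed.

(** Since cosh rho = 1 + 2 sinh^2 (rho / 2), the definition of the metric of the
    ball through sinh and that of the half space through cosh take one form. *)
Lemma cosh_double a : cosh (a + a) = 1 + 2 * sinh a ^+ 2.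
Proof. by rewrite coshD; have := cosh2_sinh2 a; rewrite !expr2; lra. Qed.

Lemma cosh_gt0 a : 0 < cosh a.
Proof. by rewrite divr_gt0 ?addr_gt0 ?expR_gt0. Qed.

Lemma sinh_ge0 a : 0 <= a -> 0 <= sinh a.
Proof. by move=> a0; rewrite divr_ge0// subr_ge0 ler_expR; lra. Qed.

Lemma cosh_lt a b : 0 <= a -> a < b -> cosh a < cosh b.
Proof.
move=> a0 ab; rewrite -subr_gt0.
have -> : cosh b - cosh a = (expR b - expR a) * (1 - expR (- (a + b))) / 2.
  have ea : expR a * expR (- a) = 1 by rewrite -expRD subrr expR0.
  have eb : expR b * expR (- b) = 1 by rewrite -expRD subrr expR0.
  by rewrite /cosh opprD expRD mulrBl !mulrBr !mulr1 mulrCA eb mulrA ea; ring.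
by rewrite divr_gt0// mulr_gt0// subr_gt0 ?ltr_expR ?expR_lt1//; lra.
Qed.

Lemma cosh_le_le a b : 0 <= b -> cosh a <= cosh b -> a <= b.
Proof. by move=> b0; apply: contraTT; rewrite -!ltNge; exact: cosh_lt. Qed.

Lemma cosh_inj_ge0 a b : 0 <= a -> 0 <= b -> cosh a = cosh b -> a = b.
Proof.
move=> a0 b0 ab; apply/le_anti/andP.
by split; apply: cosh_le_le => //; rewrite ab.
Qed.

Lemma sinh_ge_half t : 0 <= t -> t / 2 <= sinh t.
Proof.
move=> t0; rewrite /sinh; have := expR_ge1Dx t.
have : expR (- t) <= 1 by rewrite -expR0 ler_expR; lra.
by lra.
Qed.

Lemma sinh_le_double t : 0 <= t <= 1 / 2 -> sinh t <= 2 * t.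
Proof.
move=> /andP[t0 t1]; rewrite /sinh.
have e : expR t * expR (- t) = 1 by rewrite -expRD subrr expR0.
have := expR_ge1Dx (- t); have := expR_gt0 t; nra.
Qed.

End HyperbolicFunctions.

(** * Angles and arc cosines *)

Section AngleComparison.
Variables (R : realType) (n : nat).
Implicit Types (c k : R) (x y z : 'rV[R]_n).

Lemma sinMVT (t : R) : 0 <= t ->
  exists2 s, 0 <= s <= t & sin t = cos s * t.
Proof.
move=> t0; have cs : {within `[0, t], continuous (@sin R)}.
  by apply: continuous_subspaceT; exact: continuous_sin.
have [s] := MVT_segment t0 (fun (r : R) _ => is_derive_sin r) cs.
by rewrite in_itv /= sin0 !subr0 => ? ?; exists s.
Qed.

(** The left side is the sine of the angle, which never exceeds the angle. *)
Lemma sqrt_le_acos c : -1 <= c <= 1 -> Num.sqrt (1 - c ^+ 2) <= acos c.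
Proof.
move=> c1; rewrite -sin_acos//; have a0 := acos_ge0 c1.
have [s _ ->] := sinMVT a0.
by rewrite -[leRHS]mul1r ler_wpM2r// cos_le1.
Qed.

(** The cosine stays above 1 / 2 on the whole interval from 0 to the angle, so
    by the mean value theorem the sine is at least half of the angle. *)
Lemma acos_le_sqrt c : 1 / 2 <= c <= 1 -> acos c <= 2 * Num.sqrt (1 - c ^+ 2).
Proof.
move=> /andP[c12 c1]; have cE : -1 <= c <= 1 by apply/andP; lra.
rewrite -sin_acos//; have a0 := acos_ge0 cE; have api := acos_lepi cE.
have [s /andP[s0 sa] ->] := sinMVT a0.
suff : c <= cos s by nra.
have -> : c = cos (acos c) by rewrite acosK// in_itv.
rewrite leNgt ltr_cos ?in_itv /= -?leNgt ?s0 ?a0 ?api//.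
exact: le_trans api.
Qed.

(** Law of cosines:
    2 |x - z| |y - z| (1 - cos) = |x - y|^2 - (|x - z| - |y - z|)^2,
    so 1 - cos is at most k^2 / 2. *)
Lemma angle_le x y z a b k : 0 < a <= enorm (x - z) -> 0 < b <= enorm (y - z) ->
  0 <= k <= 1 -> dotv (x - y) (x - y) <= k ^+ 2 * (a * b) ->
  angle x z y <= 2 * k.
Proof.
move=> /andP[a0 aX] /andP[b0 bY] /andP[k0 k1]; rewrite /angle.
have -> : x - y = (x - z) - (y - z) by rewrite opprB addrA subrK.
move: (x - z) (y - z) aX bY => X Y aX bY.
have [X0 Y0] : 0 < enorm X /\ 0 < enorm Y by split; lra.
have := dotv_le X Y; rewrite !dotvE -!sqr_enorm (dotvC Y X).
set p := enorm X in aX X0 *; set q := enorm Y in bY Y0 *; set d := dotv X Y.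
move=> dpq h; have pq : 0 < p * q by exact: mulr_gt0.
have abpq : a * b <= p * q by rewrite ler_pM// ltW.
have k2 : k ^+ 2 <= 1 by rewrite expr_le1.
have [c1 c2] : 1 - k ^+ 2 / 2 <= d / (p * q) /\ d / (p * q) <= 1.
  rewrite ler_pdivlMr// ler_pdivrMr//; split; last by lra.
  have := sqr_ge0 (p - q); have := sqr_ge0 k; nra.
apply: le_trans (acos_le_sqrt _) _; first by apply/andP; lra.
rewrite ler_pM2l// -[leRHS]ger0_norm// -sqrtr_sqr ler_wsqrtr//; nra.
Qed.

(** The Gram determinant of x - z and y - x is the squared area of the
    parallelogram that x - z and y - z span, that is, the square of
    |x - z| |y - z| times the sine of the angle, and the sine is a lower bound
    for the angle. *)
Lemma angle_ge x y z g : 0 < enorm (x - z) -> 0 < enorm (y - z) -> 0 <= g ->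
  g ^+ 2 <= dotv (x - z) (x - z) * dotv (y - x) (y - x)
            - dotv (x - z) (y - x) ^+ 2 ->
  g / (enorm (x - z) * enorm (y - z)) <= angle x z y.
Proof.
have -> : y - x = (y - z) - (x - z) by rewrite opprB addrA subrK.
move=> X0 Y0 g0; rewrite /angle; move: (x - z) (y - z) X0 Y0 => X Y X0 Y0.
rewrite !dotvE -!sqr_enorm (dotvC Y X).
have := dotv_sqr_le X Y; rewrite -!sqr_enorm.
set p := enorm X in X0 *; set q := enorm Y in Y0 *; set d := dotv X Y.
move=> dpq h; have pq : 0 < p * q by exact: mulr_gt0.
have c2 : (d / (p * q)) ^+ 2 <= 1.
  by rewrite expr_div_n ler_pdivrMr ?exprn_gt0// mul1r exprMn.
apply: le_trans (sqrt_le_acos _); last first.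
  by rewrite -ler_norml -(@expr_le1 _ 2)// real_normK ?num_real.
rewrite -[leLHS]ger0_norm ?divr_ge0 ?(ltW pq)// -sqrtr_sqr ler_wsqrtr//.
rewrite lerBrDr 2!expr_div_n -mulrDl ler_pdivrMr ?exprn_gt0// mul1r exprMn.
by move: h; rewrite !expr2; lra.
Qed.

End AngleComparison.

(** * Heights and chords in the two models *)

Section Models.
Variables (R : realType) (n : nat).
Implicit Types (m : model) (x y z u v : 'rV[R]_n.+1) (s t : R).

(** The density of the hyperbolic metric is the reciprocal of this function in
    both models, and the boundary of the model is its zero set. *)
Definition height m x : R :=
  match m with Ball => (1 - dotv x x) / 2 | Half => x ord0 ord_max end.

(** The Minkowski length of the chord between the two points of the hyperboloid
    that represent [x] and [y]; it equals 2 sinh (rho / 2). *)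
Definition chord m x y : R :=
  enorm (x - y) / Num.sqrt (height m x * height m y).

Lemma enorm_lt1 x : (enorm x < 1) = (dotv x x < 1).
Proof. by rewrite -[X in enorm x < X]sqrtr1 ltr_sqrt. Qed.

Lemma height_gt0 m x : domain m x -> 0 < height m x.
Proof.
by case: m => //=; rewrite /unit_ball /= enorm_lt1; lra.
Qed.

Lemma chord_ge0 m x y : 0 <= chord m x y.
Proof. by rewrite divr_ge0 ?enorm_ge0 ?sqrtr_ge0. Qed.

Lemma chordC m x y : chord m x y = chord m y x.
Proof. by rewrite /chord -enormN opprB (mulrC (height m y)). Qed.

Lemma sqr_chord m x y : domain m x -> domain m y ->
  chord m x y ^+ 2 = dotv (x - y) (x - y) / (height m x * height m y).
Proof.
move=> /height_gt0 hx /height_gt0 hy.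
by rewrite expr_div_n sqr_enorm sqr_sqrtr// ltW// mulr_gt0.
Qed.

Lemma rho_ge0 m x y : domain m x -> domain m y -> 0 <= rho m x y.
Proof.
case: m => /= [_ _|]; last exact: rho_half_ge0.
rewrite /rho_ball mulr_ge0// /arsinh ln_ge0//.
set q := (_ / _); have q0 : 0 <= q.
  by rewrite divr_ge0 ?mulr_ge0 ?enorm_ge0 ?sqrtr_ge0.
rewrite -[leLHS]add0r lerD// -[leLHS]sqrtr1 ler_wsqrtr// lerDr sqr_ge0//.
Qed.

Lemma cosh_rho m x y : domain m x -> domain m y ->
  cosh (rho m x y) = 1 + chord m x y ^+ 2 / 2.
Proof.
move=> Dx Dy; rewrite sqr_chord//; move: Dx Dy.
have := @height_gt0 m x; have := @height_gt0 m y.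
case: m => /= hy hx Dx Dy; move: (hx Dx) (hy Dy) => {}hx {}hy.
  have -> : rho_ball x y = rho_ball x y / 2 + rho_ball x y / 2 by lra.
  rewrite cosh_double sinh_rho_ball !sqr_enorm expr_div_n exprMn sqr_enorm.
  rewrite !sqr_sqrtr.
  - by field; lra.
  - lra.
  - lra.
rewrite cosh_rho_half// sqr_enorm; congr (_ + _); field.
by rewrite !gt_eqF.
Qed.

Lemma chordE m x y : domain m x -> domain m y ->
  chord m x y = 2 * sinh (rho m x y / 2).
Proof.
move=> Dx Dy; have r0 := rho_ge0 Dx Dy.
have := cosh_rho Dx Dy.
rewrite {1}(_ : rho m x y = rho m x y / 2 + rho m x y / 2); last by lra.
rewrite cosh_double => h.
have s0 : 0 <= sinh (rho m x y / 2) by rewrite sinh_ge0// divr_ge0.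
have s20 : 0 <= 2 * sinh (rho m x y / 2) by lra.
apply/eqP; rewrite -(@eqrXn2 _ 2 _ _ isT (chord_ge0 _ _ _) s20); apply/eqP.
by rewrite [RHS]exprMn; lra.
Qed.

Lemma rho_le_chord m x y : domain m x -> domain m y ->
  rho m x y <= 2 * chord m x y.
Proof.
move=> Dx Dy; rewrite chordE//; have r0 := rho_ge0 Dx Dy.
have := @sinh_ge_half R (rho m x y / 2); lra.
Qed.

Lemma chord_le_rho m x y : domain m x -> domain m y -> rho m x y <= 1 ->
  chord m x y <= 2 * rho m x y.
Proof.
move=> Dx Dy r1; rewrite chordE//; have r0 := rho_ge0 Dx Dy.
have : 0 <= rho m x y / 2 <= 1 / 2 by apply/andP; lra.
by move/sinh_le_double; lra.
Qed.

(** * The hyperboloid: triangle inequality and midpoints *)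

Definition lorentz (s : R) u (t : R) v : R := s * t - dotv u v.

(** The isometry of a model onto the hyperboloid.  In the ball,
    1 - |x|^2 = 2 h(x) and the last term of [embed_space] vanishes, which leaves
    inverse stereographic projection; in the half space it replaces the last
    coordinate x_n / h(x) = 1 by (1 - |x|^2) / (2 x_n).  The same two formulas
    thus serve both models. *)
Definition embed_time m x : R := (1 + dotv x x) / (2 * height m x).

Definition embed_space m x : 'rV[R]_n.+1 :=
  (height m x)^-1 *: x +
  ((1 - dotv x x) / (2 * height m x) - 1) *: delta_mx ord0 ord_max.

Lemma dotv_last :
  dotv (delta_mx ord0 ord_max : 'rV[R]_n.+1) (delta_mx ord0 ord_max) = 1.
Proof. by rewrite dotv_delta mxE !eqxx. Qed.

Lemma lorentz_embed m x y : domain m x -> domain m y ->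
  lorentz (embed_time m x) (embed_space m x)
    (embed_time m y) (embed_space m y) = 1 + chord m x y ^+ 2 / 2.
Proof.
move=> Dx Dy; rewrite sqr_chord//.
have := height_gt0 Dx; have := height_gt0 Dy.
rewrite /lorentz /embed_time /embed_space !dotvE dotv_last.
rewrite !(dotvC (delta_mx _ _)) !dotv_delta (dotvC y x).
case: m {Dx Dy} => /= hy hx; last by field; rewrite !gt_eqF.
field; apply/andP; split; rewrite gt_eqF//; lra.
Qed.

Lemma embed_time_gt0 m x : domain m x -> 0 < embed_time m x.
Proof.
move=> /height_gt0 h; rewrite divr_gt0 ?mulr_gt0//.
by have := dotv_ge0 x; lra.
Qed.

Lemma chordxx m x : chord m x x = 0.
Proof. by rewrite /chord subrr /enorm dotv0l sqrtr0 mul0r. Qed.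

Lemma embed_unit m x : domain m x ->
  embed_time m x ^+ 2 = 1 + dotv (embed_space m x) (embed_space m x).
Proof.
move=> Dx; have := lorentz_embed Dx Dx.
by rewrite chordxx /lorentz -expr2; lra.
Qed.

(** The inverse of the embedding: u / (1 + t) in the ball.  In the half space
    the height is 1 / (t + u_n), which is positive because t > |u|. *)
Lemma embed_surj m t u : 0 < t -> t ^+ 2 = 1 + dotv u u ->
  exists x, [/\ domain m x, embed_time m x = t & embed_space m x = u].
Proof.
move=> t0 tu; pose e : 'rV[R]_n.+1 := delta_mx ord0 ord_max.
have ue : dotv u e = u ord0 ord_max by exact: dotv_delta.
case: m.
- exists ((1 + t)^-1 *: u); set x := _ *: u.
  have xx : dotv x x = (t - 1) / (1 + t).
    rewrite !dotvE (_ : dotv u u = (t - 1) * (1 + t)); last by lra.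
    by field; lra.
  have hx : height Ball x = (1 + t)^-1 by rewrite /= xx; field; lra.
  split.
  + rewrite /= /unit_ball /= enorm_lt1 xx ltr_pdivrMr; lra.
  + by rewrite /embed_time hx xx; field; lra.
  + rewrite /embed_space hx xx invrK scalerA mulfV ?scale1r; last by lra.
    rewrite (_ : _ - 1 = 0) ?scale0r ?addr0//; field; lra.
- pose s := t + u ord0 ord_max.
  have s0 : 0 < s.
    have := dotv_sqr_le u e; rewrite ue dotv_last mulr1 => h.
    rewrite /s; nra.
  exists (s^-1 *: (u + (1 - u ord0 ord_max) *: e)); set x := _ *: (_ + _).
  have xx : dotv x x = (t - u ord0 ord_max) / s.
    rewrite !dotvE (dotvC e u) ue dotv_last.
    rewrite (_ : dotv u u = t ^+ 2 - 1); last by lra.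
    by rewrite /s; field; rewrite gt_eqF.
  have hx : height Half x = s^-1.
    by rewrite /= !mxE !eqxx mulr1 addrC subrK mulr1.
  split.
  + by rewrite /= /half_space /= -[X in 0 < X]/(height Half x) hx invr_gt0.
  + by rewrite /embed_time hx xx /s; field; rewrite gt_eqF.
  + rewrite /embed_space hx xx invrK scalerA mulfV ?scale1r ?gt_eqF//.
    rewrite -addrA -scalerDl (_ : 1 - u ord0 ord_max + _ = 0) ?scale0r ?addr0//.
    by rewrite /s; field; rewrite gt_eqF.
Qed.

Lemma rhoE m x y : domain m x -> domain m y -> cosh (rho m x y) =
  lorentz (embed_time m x) (embed_space m x) (embed_time m y) (embed_space m y).
Proof. by move=> Dx Dy; rewrite lorentz_embed// cosh_rho. Qed.

(** The orthogonal complement of a timelike vector is spacelike, that is, the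
    Lorentz form is negative semidefinite there, and the Cauchy-Schwarz
    inequality holds as for any semidefinite form. *)
Lemma lorentz_cauchy_schwarz (y0 w0 v0 : R) (y w v : 'rV[R]_n.+1) :
  y0 ^+ 2 = 1 + dotv y y -> lorentz w0 w y0 y = 0 -> lorentz v0 v y0 y = 0 ->
  lorentz w0 w v0 v ^+ 2 <= lorentz w0 w w0 w * lorentz v0 v v0 v.
Proof.
move=> yy wy vy; rewrite /lorentz in wy vy *.
have spacelike (z0 : R) z : z0 * y0 - dotv z y = 0 -> 0 <= dotv z z - z0 * z0.
  move=> zy; have := dotv_sqr_le z y; have -> : dotv z y = z0 * y0 by lra.
  rewrite exprMn yy; have := dotv_ge0 y; have := dotv_ge0 z.
  by move: (dotv y y) (dotv z z) => a b; nra.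
have quad a b : 0 <= a ^+ 2 * (dotv w w - w0 * w0)
    - 2 * (a * b) * (dotv w v - w0 * v0) + b ^+ 2 * (dotv v v - v0 * v0).
  have := spacelike (a * w0 - b * v0) (a *: w - b *: v).
  rewrite !dotvE (dotvC v w) => h; apply: le_trans (h _) _; last first.
    by rewrite le_eqVlt; apply/orP; left; apply/eqP; ring.
  have -> : dotv w y = w0 * y0 by lra.
  have -> : dotv v y = v0 * y0 by lra.
  by ring.
move: (spacelike w0 w wy) (spacelike v0 v vy) quad.
rewrite -(opprB (dotv w w)) -(opprB (dotv v v)) -(opprB (dotv w v)).
rewrite mulrNN sqrrN.
move: (dotv w w - _) (dotv v v - _) (dotv w v - _) => p q r p0 q0 quad.
(* If p = 0 the value of the form at (q + 1, r) is - r^2 (q + 2). *)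
have := quad (q + 1) r.
move: p0; rewrite le_eqVlt => /predU1P[<-|p0]; first by nra.
move=> _.
have := quad r p.
have -> : r ^+ 2 * p - 2 * (r * p) * r + p ^+ 2 * q = p * (p * q - r ^+ 2).
  by ring.
by rewrite pmulr_rge0// subr_ge0.
Qed.

(** Let X, Y, Z be the points of the hyperboloid and p = cosh rho(x, y),
    q = cosh rho(y, z).  The components X - p Y and Z - q Y orthogonal to Y have
    Lorentz squares 1 - p^2 and 1 - q^2, so Cauchy-Schwarz gives
    cosh rho(x, z) - p q <= sinh rho(x, y) sinh rho(y, z). *)
Lemma rho_triangle m x y z : domain m x -> domain m y -> domain m z ->
  rho m x z <= rho m x y + rho m y z.
Proof.
move=> Dx Dy Dz.
apply: cosh_le_le; first by rewrite addr_ge0// rho_ge0.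
rewrite coshD -lerBlDl.
have [sa sb] := (sinh_ge0 (rho_ge0 Dx Dy), sinh_ge0 (rho_ge0 Dy Dz)).
rewrite (le_trans (ler_norm _))// -[leRHS](ger0_norm (mulr_ge0 sa sb)).
rewrite -(@ler_pXn2r _ 2)// ?nnegrE ?normr_ge0// !real_normK ?num_real//.
have := cosh2_sinh2 (rho m x y); have := cosh2_sinh2 (rho m y z).
rewrite !rhoE// => qE pE; rewrite [X in _ <= X]exprMn.
have -> : sinh (rho m x y) ^+ 2 =
  lorentz (embed_time m x) (embed_space m x)
    (embed_time m y) (embed_space m y) ^+ 2 - 1 by lra.
have -> : sinh (rho m y z) ^+ 2 =
  lorentz (embed_time m y) (embed_space m y)
    (embed_time m z) (embed_space m z) ^+ 2 - 1 by lra.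
move: (embed_unit Dx) (embed_unit Dy) (embed_unit Dz).
move: {qE pE} (embed_time m x) (embed_space m x)
  (embed_time m y) (embed_space m y)
  (embed_time m z) (embed_space m z) => x0 X y0 Y z0 Z xx yy zz.
set p := lorentz x0 X y0 Y; set q := lorentz y0 Y z0 Z.
have := @lorentz_cauchy_schwarz y0 (x0 - p * y0) (z0 - q * y0)
  Y (X - p *: Y) (Z - q *: Y) yy.
rewrite /lorentz !dotvE (dotvC Y X) (dotvC Z Y).
have YY : dotv Y Y = y0 ^+ 2 - 1 by lra.
have XX : dotv X X = x0 ^+ 2 - 1 by lra.
have ZZ : dotv Z Z = z0 ^+ 2 - 1 by lra.
have XY : dotv X Y = x0 * y0 - p by rewrite /p /lorentz; ring.
have YZ : dotv Y Z = y0 * z0 - q by rewrite /q /lorentz; ring.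
rewrite YY XX ZZ XY YZ => h.
move: (h ltac:(ring) ltac:(ring)); move: (dotv X Z) => XZ {}h.
lra.
Qed.

(** The point (X + Y) / N of the hyperboloid, where the Lorentz square
    N^2 = 2 + 2 cosh rho of X + Y equals (2 cosh (rho / 2))^2. *)
Lemma rho_midpoint m x y : domain m x -> domain m y ->
  exists z, [/\ domain m z, rho m x z = rho m x y / 2
             & rho m z y = rho m x y / 2].
Proof.
move=> Dx Dy; pose a := rho m x y / 2; pose N := 2 * cosh a.
have a0 : 0 <= a by rewrite divr_ge0 ?rho_ge0.
have N0 : 0 < N by rewrite mulr_gt0 ?cosh_gt0.
have NE : N ^+ 2 = 2 + 2 * cosh (rho m x y).
  rewrite (_ : rho m x y = a + a); last by rewrite /a; lra.
  by rewrite cosh_double /N exprMn; have := cosh2_sinh2 a; lra.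
have ca : cosh a = (1 + cosh (rho m x y)) / N.
  apply: (mulIf (lt0r_neq0 N0)); rewrite divfK ?lt0r_neq0//.
  by rewrite (_ : cosh a = N / 2); [lra|rewrite /N; lra].
have [ux uy] := (embed_unit Dx, embed_unit Dy).
rewrite rhoE// in ca NE.
have [sx0 sy0] := (embed_time_gt0 Dx, embed_time_gt0 Dy).
have surj := @embed_surj m (N^-1 * (embed_time m x + embed_time m y))
  (N^-1 *: (embed_space m x + embed_space m y)).
have rhoxE z (Dz : domain m z) := rhoE Dx Dz.
have rhoyE z (Dz : domain m z) := rhoE Dz Dy.
move: (embed_time m x) (embed_space m x) (embed_time m y) (embed_space m y)
  ux uy ca NE sx0 sy0 surj rhoxE rhoyE
  => s u t v us vt ca NE s0 t0 surj rxE ryE.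
move: ca NE; set c := lorentz s u t v => ca NE.
have uu : dotv u u = s ^+ 2 - 1 by lra.
have vv : dotv v v = t ^+ 2 - 1 by lra.
have uv : dotv u v = s * t - c by rewrite /c /lorentz; ring.
have N1 : 1 = N^-1 ^+ 2 * (2 + 2 * c) by rewrite -NE; field; rewrite gt_eqF.
have [||z [Dz zt zs]] := surj.
- by rewrite mulr_gt0 ?invr_gt0 ?addr_gt0.
- by rewrite !dotvE (dotvC v u) uu vv uv [X in _ = X + _]N1; ring.
exists z; split => //; apply: cosh_inj_ge0; rewrite ?rho_ge0//.
- by rewrite rxE// zt zs -/a ca /lorentz !dotvE uu uv; field; rewrite gt_eqF.
- by rewrite ryE// zt zs -/a ca /lorentz !dotvE vv uv; field; rewrite gt_eqF.
Qed.

End Models.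

(** * Boundary points *)

Section Boundary.
Variables (R : realType) (n : nat).
Implicit Types (m : model) (x y z u v : 'rV[R]_n.+1).

Lemma domainE m x : domain m x <-> 0 < height m x.
Proof.
case: m => //=; rewrite /unit_ball /= enorm_lt1; split; lra.
Qed.

Lemma domain_open m : open (@domain R n m).
Proof.
case: m => /=.
- apply: (@open_comp _ _ (@enorm R n.+1) [set t | t < 1]) => [x _|].
    exact: enorm_continuous.
  exact: open_lt.
- apply: (@open_comp _ _ (fun x : 'rV[R]_n.+1 => x ord0 ord_max)
    [set t | 0 < t]) => [x _|]; first exact: coord_continuous.
  exact: open_gt.
Qed.

Lemma boundary_notin m z : boundary (domain m) z -> ~ domain m z.
Proof. by case=> _; rewrite ((interior_id _).1 (@domain_open m)). Qed.

(** In the ball, 1 - |x| = 2 h(x) / (1 + |x|) is at least h(x). *)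
Lemma height_le_dist m x z : domain m x -> ~ domain m z ->
  height m x <= enorm (x - z).
Proof.
case: m => /=.
- rewrite /unit_ball /= -sqr_enorm => x1 /negP; rewrite -leNgt => z1.
  have := enormB_ge z x; rewrite -(enormN (z - x)) opprB.
  by have := enorm_ge0 x; nra.
- rewrite /half_space /= => x0 /negP; rewrite -leNgt => z0.
  apply: le_trans (coord_le_enorm _ ord_max).
  by apply: le_trans (ler_norm _); rewrite !mxE; lra.
Qed.

(** Every neighbourhood of [z] meets the model: move from [z] towards the centre
    of the ball, or upwards in the half space. *)
Lemma boundary_height0 m z : height m z = 0 -> boundary (domain m) z.
Proof.
move=> z0; split; last first.
  by move=> /interior_subset /domainE; rewrite z0 ltxx.
have [u zu] : exists u, forall t, 0 < t < 1 -> domain m (z + t *: u).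
  case: m z0 => /= z0.
  - exists (- z) => t /andP[t0 t1]; apply/(@domainE Ball) => /=.
    have zz : dotv z z = 1 by lra.
    have : 0 < t * (1 - t) by rewrite mulr_gt0//; lra.
    by rewrite !dotvE zz; lra.
  - exists (delta_mx ord0 ord_max) => t /andP[t0 t1].
    by apply/(@domainE Half); rewrite /= !mxE z0 !eqxx mulr1 add0r.
move=> B zB.
have cu : {for 0, continuous (fun t : R => z + t *: u)}.
  by apply: cvgD; [exact: cvg_cst|exact: scalel_continuous].
have /nbhs_ballP [e /= e0 Be] : \forall t \near (0 : R), B (z + t *: u).
  by apply: cu; rewrite scale0r addr0.
pose t := Num.min (e / 2) (1 / 2).
have [t0 te t1] : [/\ 0 < t, t < e & t < 1].
  by rewrite /t; case: (leP (e / 2) (1 / 2)) => ?; split; lra.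
exists (z + t *: u); split; first by apply: zu; rewrite t0.
by apply: Be; rewrite /ball /= sub0r normrN gtr0_norm.
Qed.

End Boundary.

(** * Comparison of the visual angle with the chord *)

Section VisualAngleComparison.
Variables (R : realType) (n : nat).
Implicit Types (m : model) (x y z d e f : 'rV[R]_n.+2).

(** Two coordinates are enough, and this is where the dimension must be at
    least 2: in dimension 1 no such vector exists unless x = 0. *)
Lemma exists_unit_orthogonal x : exists2 e, dotv e e = 1 & dotv x e = 0.
Proof.
pose p : R := x ord0 ord0; pose q : R := x ord0 ord_max.
have [s [t st pq]] : exists s, exists2 t, s ^+ 2 + t ^+ 2 = 1 &
    s * p + t * q = 0.
  have [pq0|pq0] := eqVneq (p ^+ 2 + q ^+ 2) 0.
    exists 1, 0; first by rewrite expr1n expr0n addr0.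
    have : 0 <= p ^+ 2 by exact: sqr_ge0.
    have : 0 <= q ^+ 2 by exact: sqr_ge0.
    move=> q0 p0; have /eqP p2 : p ^+ 2 = 0 by lra.
    rewrite sqrf_eq0 in p2. by rewrite (eqP p2) mulr0 mul0r addr0.
  pose N := Num.sqrt (p ^+ 2 + q ^+ 2).
  have N2 : N ^+ 2 = p ^+ 2 + q ^+ 2 by rewrite sqr_sqrtr// addr_ge0// sqr_ge0.
  have N0 : N != 0 by rewrite -sqrf_eq0 N2.
  exists (q / N), (- p / N); last by ring.
  by rewrite !expr_div_n sqrrN -mulrDl addrC -N2 divff// expf_neq0.
exists (s *: delta_mx ord0 ord0 + t *: delta_mx ord0 ord_max).
  rewrite !dotvE !dotv_delta !mxE !eqxx /=; move: st; rewrite !expr2; lra.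
by rewrite !dotvE !dotv_delta.
Qed.

Lemma exists_polar_frame x :
  exists f e, [/\ dotv f f = 1, dotv e e = 1, dotv f e = 0 & x = enorm x *: f].
Proof.
have [x0|x0] := eqVneq (dotv x x) 0.
  have [e ee fe] := exists_unit_orthogonal (delta_mx ord0 ord0).
  exists (delta_mx ord0 ord0), e; split => //.
    by rewrite dotv_delta mxE !eqxx.
  by rewrite /enorm x0 sqrtr0 scale0r (dotv_eq0 x0).
have [e ee xe] := exists_unit_orthogonal x.
have N0 : enorm x != 0 by rewrite -sqrf_eq0 sqr_enorm.
exists ((enorm x)^-1 *: x), e; split => //.
- by rewrite !dotvE -sqr_enorm; field.
- by rewrite dotvZl xe mulr0.
- by rewrite scalerA divff// scale1r.
Qed.

(** In the half space the two boundary points are the foot of the vertical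
    through [x] moved horizontally by h(x) in opposite directions.  In the ball
    they are the points at angle plus and minus alpha from the radius through
    [x], where tan (alpha / 2) = (1 - |x|) / 2, so that their distance from [x]
    is of the order of 1 - |x| both along the radius and across it. *)
Lemma boundary_cross m x : domain m x ->
  exists e1 e2 a b,
  [/\ [/\ dotv e1 e1 = 1, dotv e2 e2 = 1 & dotv e1 e2 = 0],
      height m x / 2 <= a <= 2 * height m x,
      height m x / 2 <= b <= 2 * height m x,
      boundary (domain m) (x - (a *: e1 + b *: e2)) &
      boundary (domain m) (x - (a *: e1 - b *: e2))].
Proof.
move=> Dx; have hx := height_gt0 Dx; case: m Dx hx => /= Dx hx.
- have [f [e [ff ee fe xf]]] := exists_polar_frame x.
  pose r := enorm x; pose t := (1 - r) / 2.
  have r0 : 0 <= r by exact: enorm_ge0.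
  have t0 : 0 < t by move: Dx; rewrite /unit_ball /= /t -/r; lra.
  have t2 : t <= 1 / 2 by rewrite /t; lra.
  have s0 : 0 < 1 + t ^+ 2 by have := sqr_ge0 t; lra.
  (* c and s are the cosine and the sine of alpha, with t = tan (alpha / 2). *)
  pose c := (1 - t ^+ 2) / (1 + t ^+ 2); pose s := 2 * t / (1 + t ^+ 2).
  have cs : c ^+ 2 + s ^+ 2 = 1 by rewrite /c /s; field; rewrite gt_eqF.
  have xx : dotv x x = (1 - 2 * t) ^+ 2.
    by rewrite -sqr_enorm -/r; congr (_ ^+ 2); rewrite /t; lra.
  have cE : c * (1 + t ^+ 2) = 1 - t ^+ 2 by rewrite divfK// gt_eqF.
  have sE : s * (1 + t ^+ 2) = 2 * t by rewrite divfK// gt_eqF.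
  exists (- f), e, (c - r), s; rewrite !dotvE ff ee fe opprK oppr0.
  have -> : r = 1 - 2 * t by rewrite /t; lra.
  have xE : x = (1 - 2 * t) *: f.
    by rewrite {1}xf -/r; congr (_ *: _); rewrite /t; lra.
  split => //; rewrite ?xx.
  + by apply/andP; split; nra.
  + by apply/andP; split; nra.
  + apply/(@boundary_height0 _ _ Ball) => /=.
    rewrite {1 2}xE !dotvE ff ee fe (dotvC e f) fe.
    by move: cs; rewrite !expr2; lra.
  + apply/(@boundary_height0 _ _ Ball) => /=.
    rewrite {1 2}xE !dotvE ff ee fe (dotvC e f) fe.
    by move: cs; rewrite !expr2; lra.
- exists (delta_mx ord0 ord_max), (delta_mx ord0 ord0).
  exists (x ord0 ord_max), (x ord0 ord_max); split.
  + by split; rewrite dotv_delta mxE ?eqxx //=.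
  + by apply/andP; lra.
  + by apply/andP; lra.
  + by apply: (@boundary_height0 _ _ Half); rewrite /= !mxE !eqxx /=; lra.
  + by apply: (@boundary_height0 _ _ Half); rewrite /= !mxE !eqxx /=; lra.
Qed.

Lemma angle_le_visual m x y z :
  boundary (domain m) z -> angle x z y <= visual_angle (domain m) x y.
Proof.
move=> bz; apply: ub_le_sup; last by exists z.
by exists pi => _ [w _ <-]; have /andP[] := angle_itv x w y.
Qed.

Lemma visual_angleC m x y :
  visual_angle (domain m) x y = visual_angle (domain m) y x.
Proof.
rewrite /visual_angle; congr sup; apply: eq_imagel => z _.
by rewrite /angle dotvC (mulrC (enorm (x - z))).
Qed.

Lemma visual_le_chord m x y : domain m x -> domain m y -> chord m x y <= 1 ->
  visual_angle (domain m) x y <= 2 * chord m x y.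
Proof.
move=> Dx Dy k1; apply: ge_sup.
  have [e1 [e2 [a [b [_ _ _ bz _]]]]] := boundary_cross Dx.
  by eexists; exists (x - (a *: e1 + b *: e2)).
move=> _ [z /boundary_notin Dz <-].
apply: (@angle_le _ _ _ _ _ (height m x) (height m y)).
- by rewrite height_gt0// height_le_dist.
- by rewrite height_gt0// height_le_dist.
- by rewrite chord_ge0.
- by rewrite sqr_chord// divfK// lt0r_neq0// mulr_gt0 ?height_gt0.
Qed.

(** The sum of the squares of the products of [d] with the two candidates is
    2 (a^2 (e1.d)^2 + b^2 (e2.d)^2), which by Bessel's inequality is at most
    2 (a^2 + b^2 - h^2) |d|^2; hence one candidate has the required Gram
    determinant.  Geometrically, a line through the tip of both candidates with
    direction [d] misses one of their origins by at least [h]. *)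
Lemma exists_transversal (e1 e2 d : 'rV[R]_n.+2) (a b h : R) :
  dotv e1 e1 = 1 -> dotv e2 e2 = 1 -> dotv e1 e2 = 0 ->
  0 <= h -> h <= a -> h <= b ->
  exists2 u, u = a *: e1 + b *: e2 \/ u = a *: e1 - b *: e2 &
    h ^+ 2 * dotv d d <= dotv u u * dotv d d - dotv u d ^+ 2.
Proof.
move=> e11 e22 e12 h0 ha hb.
have := bessel2 d e11 e22 e12.
set d1 := dotv e1 d; set d2 := dotv e2 d; set D := dotv d d => dD.
have up : dotv (a *: e1 + b *: e2) (a *: e1 + b *: e2) = a ^+ 2 + b ^+ 2.
  by rewrite !dotvE e11 e22 (dotvC e2 e1) e12; ring.
have um : dotv (a *: e1 - b *: e2) (a *: e1 - b *: e2) = a ^+ 2 + b ^+ 2.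
  by rewrite !dotvE e11 e22 (dotvC e2 e1) e12; ring.
have pd : dotv (a *: e1 + b *: e2) d = a * d1 + b * d2 by rewrite !dotvE.
have md : dotv (a *: e1 - b *: e2) d = a * d1 - b * d2 by rewrite !dotvE.
have ha2 : h ^+ 2 <= a ^+ 2 by rewrite ler_pXn2r ?nnegrE//; lra.
have hb2 : h ^+ 2 <= b ^+ 2 by rewrite ler_pXn2r ?nnegrE//; lra.
have sum : (a * d1 + b * d2) ^+ 2 + (a * d1 - b * d2) ^+ 2
    <= 2 * ((a ^+ 2 + b ^+ 2) * D - h ^+ 2 * D).
  have -> : (a * d1 + b * d2) ^+ 2 + (a * d1 - b * d2) ^+ 2
    = 2 * (a ^+ 2 * d1 ^+ 2 + b ^+ 2 * d2 ^+ 2) by ring.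
  rewrite ler_pM2l//.
  have := sqr_ge0 d1; have := sqr_ge0 d2; have := sqr_ge0 h.
  move: dD ha2 hb2; move: (a ^+ 2) (b ^+ 2) (h ^+ 2) (d1 ^+ 2) (d2 ^+ 2).
  by move=> A B H D1 D2 dD ha2 hb2 H0 D20 D10; nra.
have [p|p] := leP ((a * d1 + b * d2) ^+ 2)
    ((a ^+ 2 + b ^+ 2) * D - h ^+ 2 * D).
  by exists (a *: e1 + b *: e2); [left|rewrite up pd; lra].
by exists (a *: e1 - b *: e2); [right|rewrite um md; lra].
Qed.

(** Seen from a transversal boundary point, the sine of the angle is at least
    D / (6 (D + 3 h)), where D = |x - y| and h = h(x).  The assumption on the
    heights gives k h <= D, and t / (t + 3) is increasing. *)
Lemma chord_le_visual_sorted m x y : domain m x -> domain m y ->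
  height m x <= height m y ->
  chord m x y <= 6 * visual_angle (domain m) x y * (chord m x y + 3).
Proof.
move=> Dx Dy hxy; have h0 := height_gt0 Dx.
have [e1 [e2 [a [b [[e11 e22 e12] /andP[a1 a2] /andP[b1 b2] bp bm]]]]] :=
  boundary_cross Dx.
have [|||u uE Hu] := @exists_transversal e1 e2 (y - x) a b (height m x / 2)
  e11 e22 e12; [lra|lra|lra|].
have bz : boundary (domain m) (x - u) by case: uE => ->.
have uu : dotv u u = a ^+ 2 + b ^+ 2.
  by case: uE => ->; rewrite !dotvE e11 e22 (dotvC e2 e1) e12; ring.
have hz := height_le_dist Dx (boundary_notin bz).
have hz' := height_le_dist Dy (boundary_notin bz).
have := angle_le_visual x y bz.
have := @angle_ge _ _ x y (x - u) (height m x / 2 * enorm (y - x)).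
rewrite exprMn sqr_enorm.
have xu : x - (x - u) = u by rewrite opprB addrC subrK.
rewrite xu in hz *; move=> /(_ ltac:(lra) ltac:(lra)).
move=> /(_ ltac:(by rewrite mulr_ge0 ?enorm_ge0//; lra) Hu).
have u3 : enorm u <= 3 * height m x.
  by apply: enorm_le; [lra|rewrite uu; nra].
have y3 : enorm (y - (x - u)) <= enorm (y - x) + 3 * height m x.
  have -> : y - (x - u) = (y - x) + u by rewrite opprB addrA addrAC.
  by apply: le_trans (enormD _ _) _; lra.
have kD : chord m x y * height m x <= enorm (y - x).
  rewrite /chord -enormN opprB mulrAC ler_pdivrMr; last first.
    by rewrite sqrtr_gt0 mulr_gt0// height_gt0.
  rewrite ler_wpM2l ?enorm_ge0// -[leLHS](ger0_norm (ltW h0)).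
  by rewrite -sqrtr_sqr ler_wsqrtr// expr2 ler_pM2l.
have k0 := chord_ge0 m x y; have D0 := enorm_ge0 (y - x).
move: (chord m x y) (height m x) (enorm u) (enorm (y - (x - u)))
  (enorm (y - x)) (angle _ _ _) (visual_angle _ _ _)
  h0 hz (lt_le_trans (height_gt0 Dy) hz') u3 y3 kD k0 D0.
move=> k h p q D th v h0 hp q0 p3 q3 kD k0 D0 lb thv.
have p0 : 0 < p by lra.
have pq : 0 < p * q by exact: mulr_gt0.
rewrite ler_pdivrMr// in lb.
have v0 : 0 <= v.
  apply: le_trans thv; rewrite -(pmulr_lge0 _ pq); apply: le_trans lb.
  by rewrite mulr_ge0//; lra.
have pqh : p * q <= 3 * h * (D + 3 * h) by rewrite ler_pM// ltW.
have : h / 2 * D <= v * (3 * h * (D + 3 * h)).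
  apply: le_trans lb _; apply: le_trans (ler_wpM2l v0 pqh).
  by rewrite ler_wpM2r// ltW.
have -> : v * (3 * h * (D + 3 * h)) = h / 2 * (6 * v * (D + 3 * h)) by field.
rewrite ler_pM2l ?divr_gt0// => DD.
have [v1|v1] := leP 1 (6 * v); first by nra.
have : D * (1 - 6 * v) <= 18 * v * h by lra.
have : k * h * (1 - 6 * v) <= D * (1 - 6 * v) by rewrite ler_wpM2r//; lra.
move=> h1 h2; rewrite -(ler_pM2r h0); lra.
Qed.

Lemma chord_le_visual m x y : domain m x -> domain m y ->
  visual_angle (domain m) x y <= 1 / 12 ->
  chord m x y <= 36 * visual_angle (domain m) x y.
Proof.
move=> Dx Dy v1.
suff : chord m x y <= 6 * visual_angle (domain m) x y * (chord m x y + 3).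
  by have := chord_ge0 m x y; nra.
have [h|/ltW h] := leP (height m x) (height m y).
  exact: chord_le_visual_sorted.
by rewrite chordC visual_angleC chord_le_visual_sorted.
Qed.

(** * From a fixed scale to all scales *)

(** By induction the bound holds at the scale 2^N r, with the same constant: the
    images of the two halves of a geodesic add up by the triangle inequality in
    the target, while the halves themselves add up to the whole. *)
Lemma lipschitz_of_scale m1 m2 (f : 'rV[R]_n.+2 -> 'rV[R]_n.+2) (M r : R) :
  0 < r -> set_fun (domain m1) (domain m2) f ->
  (forall x y, domain m1 x -> domain m1 y -> rho m1 x y <= r ->
    rho m2 (f x) (f y) <= M * rho m1 x y) ->
  forall x y, domain m1 x -> domain m1 y ->
    rho m2 (f x) (f y) <= M * rho m1 x y.
Proof.
move=> r0 fD fr x y Dx Dy.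
have [N] : exists N, rho m1 x y <= 2 ^+ N * r.
  have /= := archi_boundP (x := rho m1 x y / r).
  rewrite divr_ge0 ?rho_ge0 ?ltW// => /(_ isT).
  rewrite ltr_pdivrMr// => h; exists (Num.bound (rho m1 x y / r)).
  apply: le_trans (ltW h) _; rewrite ler_pM2r// -natrX ler_nat ltnW//.
  exact: ltn_expl.
elim: N x y Dx Dy => [|N IH] x y Dx Dy h.
  by apply: fr => //; rewrite expr0 mul1r in h.
have [z [Dz xz zy]] := rho_midpoint Dx Dy.
have h2 : rho m1 x y / 2 <= 2 ^+ N * r by move: h; rewrite exprS; lra.
apply: le_trans (rho_triangle (fD _ Dx) (fD _ Dz) (fD _ Dy)) _.
have := IH x z Dx Dz; have := IH z y Dz Dy; rewrite xz zy => /(_ h2) ? /(_ h2).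
by lra.
Qed.

(** For rho(x, y) <= 1 / (48 L), writing primes for images:
    k <= 2 rho, v <= 2 k <= 4 rho, v' <= 4 L rho <= 1 / 12,
    k' <= 36 v' and rho' <= 2 k'.  The scale 1 / (48 L) is chosen to make
    v' <= 1 / 12, and the constants multiply to 4 * 36 * 2 = 288. *)
Lemma rho_lipschitz_of_visual m1 m2 (f : 'rV[R]_n.+2 -> 'rV[R]_n.+2) (L : R) :
  1 <= L -> set_fun (domain m1) (domain m2) f ->
  (forall x y, domain m1 x -> domain m1 y ->
    visual_angle (domain m2) (f x) (f y) <= L * visual_angle (domain m1) x y) ->
  forall x y, domain m1 x -> domain m1 y ->
    rho m2 (f x) (f y) <= 288 * L * rho m1 x y.
Proof.
move=> L1 fD fL; have L0 : 0 < L by lra.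
apply: (@lipschitz_of_scale _ _ _ _ (1 / (48 * L))) => //.
  by rewrite divr_gt0 ?mulr_gt0.
move=> x y Dx Dy; rewrite ler_pdivlMr ?mulr_gt0// => r48.
have r0 := rho_ge0 Dx Dy.
have r1 : 48 * rho m1 x y <= 1 by nra.
have kr := chord_le_rho Dx Dy ltac:(lra).
have v1 := visual_le_chord Dx Dy ltac:(lra).
have v2 : visual_angle (domain m2) (f x) (f y) <= 4 * L * rho m1 x y.
  apply: le_trans (fL _ _ Dx Dy) _.
  by rewrite (mulrC 4) -mulrA ler_pM2l//; lra.
have := chord_le_visual (fD _ Dx) (fD _ Dy) ltac:(lra).
by have := rho_le_chord (fD _ Dx) (fD _ Dy); lra.
Qed.

Lemma lipschitz_metric_continuous m1 m2
    (f : 'rV[R]_n.+2 -> 'rV[R]_n.+2) (M : R) :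
  0 < M -> (forall x y, domain m1 x -> domain m1 y ->
    rho m2 (f x) (f y) <= M * rho m1 x y) ->
  metric_continuous (domain m1) (rho m1) (rho m2) f.
Proof.
move=> M0 fM x Dx e e0; exists (e / M); first by rewrite divr_gt0.
move=> y Dy; rewrite ltr_pdivlMr// mulrC; exact: le_lt_trans (fM _ _ _ _).
Qed.

End VisualAngleComparison.

(* The ambient dimension n.+2 ranges over the integers at least 2. *)
Theorem theorem1p4 (R : realType) (n : nat) (m1 m2 : model)
    (f : 'rV[R]_n.+2 -> 'rV[R]_n.+2) :
  bilipschitz (domain m1) (visual_angle (domain m1))
    (domain m2) (visual_angle (domain m2)) f ->
  bilipschitz (domain m1) (rho m1) (domain m2) (rho m2) f.
Proof.
move=> [L L1 [[fD [_ [g [gD fK gK _]]]] fL]]; have L0 : 0 < L by lra.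
have M0 : 0 < 288 * L by lra.
have f_lip := rho_lipschitz_of_visual L1 fD (fun x y Dx Dy => (fL x y Dx Dy).2).
have gL x y : domain m2 x -> domain m2 y ->
    visual_angle (domain m1) (g x) (g y) <= L * visual_angle (domain m2) x y.
  move=> Dx Dy; have [+ _] := fL _ _ (gD _ Dx) (gD _ Dy).
  by rewrite !gK// ler_pdivrMr// mulrC.
have g_lip := rho_lipschitz_of_visual L1 gD gL.
exists (288 * L); first by lra.
split.
  split=> //; split; first exact: lipschitz_metric_continuous f_lip.
  by exists g; split => //; exact: lipschitz_metric_continuous g_lip.
move=> x y Dx Dy; split; last exact: f_lip.
rewrite ler_pdivrMr// mulrC.
by have := g_lip _ _ (fD _ Dx) (fD _ Dy); rewrite !fK.
Qed.
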